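(* Let $t_0>0$ and $x_0,\beta_1,\beta_2\in\mathbb{R}$. Assume that (i) the process $B_t$ is continuous and has a jointly continuous local time $L_t^x$, and (ii) if $A_t$ is an adapted process with $A_{t_0}=x_0$ whose paths are Lipschitz continuous with Lipschitz constant $M$ (for some $M<\infty$), then for each $x$ the law of $\{B_t+A_t,\ t_0\le t\le t_0+s\}$ under $\mathbb{P}^x$ is mutually absolutely continuous with respect to the law of $\{B_t,\ t_0\le t\le t_0+s\}$ under $\mathbb{P}^{x+x_0}$, for every $s>0$. Then with probability one there exist a random $s_0>0$ and a unique Lipschitz solution on $[t_0,t_0+s_0]$ of the equation $$\frac{dX_t}{dt}=\begin{cases}\beta_1&\text{if }X_t<B_t,\\ \beta_2&\text{if }X_t>B_t,\end{cases}\qquad X(t_0)=x_0. $$ If in addition $B_t$ is strong Markov, then there is a unique Lipschitz solution of this equation for all $t\ge t_0$.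
   Context: A solution is a function $t\mapsto X_t$ with $X_{t_0}=x_0$ for which the displayed derivative condition holds at every $t$ with $X_t\ne B_t$ (no condition on the derivative when $X_t=B_t$). ''Adapted'' refers to the filtration $\mathcal F_t=\sigma(B_s,s\in[t_0,t])$. $\mathbb{P}^x$ denotes the distribution of $\{B_t,t\ge t_0\}$ conditioned on $\{B_{t_0}=x\}$ (no Markov property is implied by this notation). $L^x_t$ is a local time for $B$ if it is the occupation time density: $\int_{-\infty}^\infty h(x)L_t^x\,dx=\int_0^t h(B_s)\,ds$ a.s. for all bounded measurable $h$. *)

(* Defs.v *)
From mathcomp Require Import all_boot all_order all_algebra.
From mathcomp Require Import all_classical all_reals all_analysis.
Set Implicit Arguments.
Unset Strict Implicit.
Unset Printing Implicit Defensive.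
Import Order.TTheory GRing.Theory Num.Theory.
Import numFieldNormedType.Exports.
Local Open Scope classical_set_scope.
Local Open Scope ring_scope.

(* Processes [Y : R -> U -> R] are indexed by all of R, but only the times in
   the index set [I] under consideration (here always within [0, +oo[) are
   ever looked at. [<<s process_events Y I >>] is sigma(Y_t, t \in I). *)
Definition process_events (R : realType) (U : Type) (Y : R -> U -> R)
    (I : set R) : set (set U) :=
  \bigcup_(t in I) preimage_set_system setT (Y t) measurable.

Definition coordinate (R : realType) (t : R) (w : R -> R) : R := w t.

(* Path space with the product sigma-algebra of R^I: a path is a function on
   all of R, but the sigma-algebra only sees its values on I. *)
Notation path_space R I :=
  (g_sigma_algebraType (process_events (@coordinate R) I)).

Section definitions.
Context (R : realType).
Implicit Types (x t s : R) (I : set R).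

Definition continuous_process (T : Type) (B : R -> T -> R) : Prop :=
  forall w, {within `[0, +oo[, continuous (B ^~ w)}.

(* [L t x] is the local time at level x up to time t, i.e., L_t^x. *)
Definition jointly_continuous_local_time d (T : measurableType d)
    (P : probability T R) (B : R -> {RV P >-> R})
    (L : R -> R -> {RV P >-> R}) : Prop :=
  {ae P, forall w, {within [set tx : R * R | 0 <= tx.1],
                      continuous (fun tx => L tx.1 tx.2 w)}} /\
  forall t (h : R -> R), 0 <= t ->
    measurable_fun setT h -> (exists K, forall x, `|h x| <= K) ->
    {ae P, forall w,
      (\int[lebesgue_measure]_x (h x * L t x w)%:E =
       \int[lebesgue_measure]_(s in `[0%R, t]) (h (B s w))%:E)%E}.

(* [Px x] is P^x: a version, defined for every x, of the regular conditional
   distribution of the path (B_t)_(t >= t0) given B_t0 = x. *)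
Definition conditional_path_law d (T : measurableType d)
    (P : probability T R) (B : R -> {RV P >-> R}) t0
    (Px : R.-pker R ~> path_space R `[t0, +oo[) : Prop :=
  (forall x, Px x [set w | w t0 = x] = 1%E) /\
  forall (C : set R) (D : set (path_space R `[t0, +oo[)),
    measurable C -> measurable D ->
    P [set w | C (B t0 w) /\ D (B ^~ w)] =
    (\int[distribution P (B t0)]_(x in C) Px x D)%E.

(* A process adapted to the filtration sigma(B_s, s \in [t0, t]), as a
   functional of the path of B. *)
Definition adapted t0 (A : R -> (R -> R) -> R) : Prop :=
  forall t, t0 <= t ->
    measurable_fun setT (A t : path_space R `[t0, t] -> R).

Definition mutually_absolutely_continuous d (T : measurableType d)
    (m1 m2 : set T -> \bar R) : Prop :=
  m1 `<< m2 /\ m2 `<< m1.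

(* The coordinate process of the path space plays the role of B under P^x. *)
Definition lipschitz_shift_equivalence t0 x0
    (Px : R.-pker R ~> path_space R `[t0, +oo[) : Prop :=
  forall (A : R -> (R -> R) -> R) (M : R),
    adapted t0 A ->
    (forall w, A t0 w = x0) ->
    (forall w, M.-lipschitz_(`[t0, +oo[) (A ^~ w)) ->
    forall x s, 0 < s ->
      mutually_absolutely_continuous
        (pushforward (Px x)
           (fun w => (fun t => w t + A t w) : path_space R `[t0, t0 + s]))
        (pushforward (Px (x + x0))
           (fun w => w : path_space R `[t0, t0 + s])).

Section strong_markov.
Context d (T : measurableType d) (P : probability T R) (B : R -> {RV P >-> R}).

Definition stopping_time t0 (tau : T -> R) : Prop :=
  (forall w, t0 <= tau w) /\
  forall t, t0 <= t ->
    <<s process_events B `[t0, t] >> [set w | tau w <= t].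

Definition stopped_event t0 (tau : T -> R) (E : set T) : Prop :=
  forall t, t0 <= t ->
    <<s process_events B `[t0, t] >> (E `&` [set w | tau w <= t]).

(* At every finite stopping time tau, the conditional probability given F_tau
   of any event D of the future (B_(tau + u))_(u >= 0) is a function of the
   present only. The present is the pair (tau, B_tau), so that
   time-homogeneity is not presupposed; a stopping time that may be infinite
   reduces to the finite ones tau /\ n on the events {tau <= n}. *)
Definition strong_markov t0 : Prop :=
  forall tau : T -> R, stopping_time t0 tau ->
  forall D : set (path_space R `[0, +oo[), measurable D ->
  exists g : R * R -> R,
    [/\ measurable_fun setT g, (forall z, 0 <= g z) &
        forall E, stopped_event t0 tau E ->
          P (E `&` [set w | D (fun u => B (tau w + u) w)]) =
          (\int[P]_(w in E) (g (tau w, B (tau w) w))%:E)%E].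

End strong_markov.

(* The derivative is taken within I, hence one-sided at an endpoint of I. *)
Definition lipschitz_solution (b1 b2 x0 : R) (b : R -> R) t0 I
    (X : R -> R) : Prop :=
  [/\ exists K : R, K.-lipschitz_I X,
      X t0 = x0,
      forall t, I t -> X t < b t ->
        (X u - X t) / (u - t) @[u --> within I t^'] --> b1 &
      forall t, I t -> X t > b t ->
        (X u - X t) / (u - t) @[u --> within I t^'] --> b2].

Definition unique_lipschitz_solution (b1 b2 x0 : R) (b : R -> R) t0 I : Prop :=
  exists2 X, lipschitz_solution b1 b2 x0 b t0 I X &
    forall Y, lipschitz_solution b1 b2 x0 b t0 I Y -> {in I, Y =1 X}.

End definitions.

(* Main.v *)
(**
A solution X, adapted to B and Lipschitz, exists for every continuous path: take
the upper limit of the Euler schemes of mesh 1/(n+1). Near a time t with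
X_t <> B_t all schemes that come close to X_t are eventually affine with the
right slope, so their upper limit is affine there.

The process B + (2 x0 - X) starts from B + x0, hence by (ii), used for this drift
and for the constant drift x0, every event that has probability zero for B + x0
has probability zero for B + 2 x0 - X. Thus B - X inherits at level 0 what the
local time of B gives at level x0: the time spent within e of the level during
[s, t] is at most o(1) e as t - s -> 0, uniformly in e.

If Y is another solution with constant K, D = Y - X is constant on the intervals
where |B - X| > |D|, so if |D| <= e on [s, t] and D_s = 0 then |D| is at most
(K + max |beta|) o(1) e <= e / 2 on [s, t], and iterating gives D = 0. As X
is defined for all times this already gives uniqueness on [t0, +oo[.
*)
Require Import Defs.
From mathcomp Require Import all_boot all_order all_algebra.
From mathcomp Require Import all_classical all_reals all_analysis.
From mathcomp Require Import measurable_realfun.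
From mathcomp Require Import ring lra.
Set Implicit Arguments.
Unset Strict Implicit.
Unset Printing Implicit Defensive.
Import Order.TTheory GRing.Theory Num.Theory.
Import numFieldNormedType.Exports.
Local Open Scope classical_set_scope.
Local Open Scope ring_scope.

(** * Measurability of maps from and into path spaces *)

Lemma measurable_coordinate (R : realType) (I : set R) (t : R) : I t ->
  measurable_fun setT ((fun w => w t) : path_space R I -> R).
Proof.
move=> It _ A mA; rewrite setTI; apply: sub_sigma_algebra.
by exists t => //; exists A => //; rewrite setTI.
Qed.

Lemma measurable_fun_path d (T : measurableType d) (R : realType) (I : set R)
    (f : T -> path_space R I) :
  (forall t, I t -> measurable_fun setT (fun x => f x t)) ->
  measurable_fun setT f.
Proof.
move=> mf; apply: (@measurability _ _ _ _ setT f (process_events (@coordinate R) I)) => //.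
move=> _ [_ [t It [A mA <-]] <-]; rewrite setTI.
by have := mf t It measurableT A mA; rewrite !setTI.
Qed.

(** * Upper limits of bounded sequences: eventual upper and frequent lower bounds *)

Section limn_sup_bounded.
Variable R : realType.
Implicit Types (u : R^nat) (a e : R).

Lemma near_lt_limn_supD u e : bounded_fun u -> 0 < e ->
  \forall n \near \oo, u n < limn_sup u + e.
Proof.
move=> ub e0; have uub := bounded_fun_has_ubound ub.
have /cvgrPdist_lt/(_ _ e0) := cvg_sups_inf uub (bounded_fun_has_lbound ub).
rewrite -limn_supE// => -[N _ NH]; exists N => // n Nn.
have : u n <= sups u n.
  by apply: ub_le_sup; [exact: has_ubound_sdrop|exists n => /=].
by have /= := NH _ Nn; rewrite distrC ltr_norml => /andP[_ h]; lra.
Qed.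

Lemma limn_supB_lt_frequently u e : bounded_fun u -> 0 < e ->
  forall N, exists2 n, (N <= n)%N & limn_sup u - e < u n.
Proof.
move=> ub e0 N; apply: contrapT => /forall2NP H.
have uub := bounded_fun_has_ubound ub.
have : sups u N <= limn_sup u - e.
  apply: ge_sup; first by exists (u N) => /=; exists N => /=.
  move=> _ [n /= Nn <-]; have [//|] := H n.
  by move/negP; rewrite -leNgt.
have : limn_sup u <= sups u N.
  rewrite limn_supE//; apply: ge_inf; last by exists N.
  exact: bounded_fun_has_lbound_sups.
by lra.
Qed.

Lemma limn_sup_le u a : bounded_fun u ->
  (\forall n \near \oo, u n <= a) -> limn_sup u <= a.
Proof.
move=> ub [N _ Na]; apply/ler_addgt0Pr => e e0.
by have [n /Na /=] := limn_supB_lt_frequently ub e0 N; lra.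
Qed.

Lemma limn_sup_ge u a : bounded_fun u ->
  (forall N, exists2 n, (N <= n)%N & a <= u n) -> a <= limn_sup u.
Proof.
move=> ub H; apply/ler_addgt0Pr => e e0.
have [N _ NH] := near_lt_limn_supD ub e0.
by have [n /NH /= + ?] := H N; lra.
Qed.

End limn_sup_bounded.

(** * Continuity within a set, uniform continuity on compacts, Lipschitz maps *)

Lemma within_continuous_ballP (R : realType) (T : pseudoMetricType R)
    (A : set T) (f : T -> R) :
  {within A, continuous f} <->
  forall x e, A x -> 0 < e ->
    exists2 d, 0 < d & forall y, A y -> ball x d y -> `|f x - f y| < e.
Proof.
split=> [/subspace_continuousP H x e Ax e0|H].
  have /cvgrPdist_lt/(_ _ e0) := H x Ax; rewrite near_withinE -nbhs_ballE.
  by move=> -[d /= d0 xd]; exists d => // y Ay xy; exact: xd.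
apply/subspace_continuousP => x Ax; apply/cvgrPdist_lt => e e0.
rewrite near_withinE -nbhs_ballE; have [d d0 xd] := H x e Ax e0.
by exists d => //= y xy Ay; exact: xd.
Qed.

(** Heine-Cantor, by a near covering with half radii. The general domain [T] serves both time
    segments and the time-level rectangles on which local time lives. *)
Lemma compact_within_unif_continuous (R : realType) (T : pseudoMetricType R)
    (K : set T) (f : T -> R) (e : R) :
  compact K -> {within K, continuous f} -> 0 < e ->
  exists2 d, 0 < d & forall x y, K x -> K y -> ball x d y -> `|f x - f y| < e.
Proof.
move=> /compact_near_coveringP cK /within_continuous_ballP cf e0.
have : \forall d \near 0^'+,
    K `<=` [set x | forall y, K x -> K y -> ball x d y -> `|f x - f y| < e].
  apply: cK => x Kx.
  have [|r r0 xr] := cf x (e / 2) Kx; first by rewrite divr_gt0.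
  exists (ball x (r / 2), [set d | d < r / 2]) => /=.
    split; first by rewrite -nbhs_ballE; exists (r / 2) => //=; rewrite divr_gt0.
    by apply: nbhs_right_lt; rewrite divr_gt0.
  move=> [y d] /= [xy dr] z Ky Kz yz.
  have xz : ball x r z.
    rewrite (splitr r); apply: ball_triangle xy _.
    exact: le_ball (ltW dr) _ yz.
  have r2 : r / 2 <= r by rewrite ler_pdivrMr// ler_peMr// ?ler1n// ltW.
  have := xr y Ky (le_ball r2 xy).
  have := xr z Kz xz.
  by rewrite !ltr_norml => /andP[? ?] /andP[? ?]; apply/andP; split; lra.
move=> h; near (0 : R)^'+ => d; exists d; first by near: d; exact: nbhs_right_gt.
move=> x y Kx Ky; apply: (near h d _ x Kx) => //.
Unshelve. all: by end_near. Qed.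

Lemma lipschitz_onP (R : realType) (k : R) (A : set R) (f : R -> R) :
  k.-lipschitz_A f <->
  forall x y, A x -> A y -> `|f x - f y| <= k * `|x - y|.
Proof.
by split=> [H x y Ax Ay|H [x y] /= [Ax Ay]]; [apply: (H (x, y))|apply: H].
Qed.

Lemma lipschitz_within_continuous (R : realType) (k : R) (A : set R)
    (f : R -> R) :
  (forall x y, A x -> A y -> `|f x - f y| <= k * `|x - y|) ->
  {within A, continuous f}.
Proof.
move=> fk; apply/within_continuous_ballP => x e Ax e0.
have k0 : 0 < `|k| + 1 by rewrite ltr_wpDl.
exists (e / (`|k| + 1)); first by rewrite divr_gt0.
move=> y Ay; rewrite /ball/= ltr_pdivlMr// => xy.
apply: le_lt_trans (fk _ _ Ax Ay) _; apply: le_lt_trans xy.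
by rewrite mulrC ler_wpM2l// (le_trans (ler_norm k))// lerDl.
Qed.

Lemma near_invn_lt (R : realType) (e : R) : 0 < e ->
  \forall n \near \oo, (n.+1%:R^-1 : R) < e.
Proof. by move=> e0; exact: near_infty_natSinv_lt (PosNum e0). Qed.

(** * Existence: the upper limit of the Euler schemes *)

Section euler.
Variables (R : realType) (b1 b2 x0 t0 : R).
Implicit Types (w b : R -> R) (n k : nat) (r s t y : R).

Let M : R := Num.max `|b1| `|b2|.

(** The tie [y = r] is given the slope [b2], an arbitrary choice since the equation prescribes no
    derivative there. *)
Definition slope y r : R := if y < r then b1 else b2.

Lemma slope_bound y r : `|slope y r| <= M.
Proof. by rewrite /slope /M le_max; case: ifP; rewrite lexx ?orbT. Qed.

Fixpoint euler n w k : R :=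
  if k is j.+1
  then euler n w j + slope (euler n w j) (w (t0 + j%:R / n.+1%:R)) / n.+1%:R
  else x0.

(** A step function instead of a linear interpolation: its value at [t] reads [w] only at grid times
    before [t]. The price is the extra [n.+1%:R^-1] in [euler_path_dist], which disappears in the
    limit. *)
Definition euler_path n w t := euler n w (Num.truncn (n.+1%:R * (t - t0))).

(** An upper limit exists for every path and is measurable in it, so no convergence of the schemes
    has to be proved. *)
Definition euler_limit w t := limn_sup (fun n => euler_path n w t).

Lemma euler_dist n w i j :
  `|euler n w i - euler n w j| <= M * (`|i%:R - j%:R| / n.+1%:R).
Proof.
wlog ij : i j / (j <= i)%N.
  move=> H; case: (leqP j i) => [/H//|/ltnW/H].
  by rewrite distrC (distrC j%:R).
rewrite -natrB// normr_nat -(subnK ij); elim: (i - j)%N => [|k IH].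
  by rewrite subrr normr0 add0n subnn mul0r mulr0.
rewrite addSn subSn ?leq_addl// addnK /= addrAC.
apply: le_trans (ler_normD _ _) _.
have -> : M * (k.+1%:R / n.+1%:R) = M * (k%:R / n.+1%:R) + M * n.+1%:R^-1.
  by rewrite -[k.+1%:R]natr1 [(_ + 1) / _]mulrDl mulrDr mul1r.
apply: lerD.
  by rewrite addnK in IH.
rewrite normrM ler_pM// ?slope_bound//.
by rewrite ger0_norm.
Qed.

Lemma truncn_time n t : t0 <= t ->
  let k := Num.truncn (n.+1%:R * (t - t0)) in
  k%:R / n.+1%:R <= t - t0 < k%:R / n.+1%:R + n.+1%:R^-1.
Proof.
move=> tt0 /=; set k := Num.truncn _.
have : k%:R <= n.+1%:R * (t - t0) < k.+1%:R.
  by apply: truncn_itv; rewrite mulr_ge0// subr_ge0.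
move=> /andP[h1 h2]; apply/andP; split; first by rewrite ler_pdivrMr// mulrC.
have -> : k%:R / n.+1%:R + n.+1%:R^-1 = k.+1%:R / n.+1%:R :> R.
  by rewrite -[k.+1%:R]natr1 mulrDl mul1r.
by rewrite ltr_pdivlMr// mulrC.
Qed.

Lemma euler_path_dist n w s t : t0 <= s -> t0 <= t ->
  `|euler_path n w s - euler_path n w t| <= M * (`|s - t| + n.+1%:R^-1).
Proof.
move=> ss0 tt0; apply: le_trans (euler_dist _ _ _ _) _.
have M0 : 0 <= M by exact: le_trans (normr_ge0 _) (slope_bound 0 0).
apply: ler_wpM2l => //.
have := truncn_time n tt0; have := truncn_time n ss0; move=> /=.
set i := Num.truncn _; set j := Num.truncn _.
have n0 : 0 < n.+1%:R^-1 :> R by [].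
have -> : `|i%:R - j%:R| / n.+1%:R = `|i%:R / n.+1%:R - j%:R / n.+1%:R| :> R.
  by rewrite -mulrBl normrM (ger0_norm (ltW n0)).
suff aux (p q e : R) : p <= s - t0 < p + e -> q <= t - t0 < q + e ->
  `|p - q| <= `|s - t| + e by exact: aux.
move=> /andP[? ?] /andP[? ?].
have := ler_norm (s - t); have := ler_norm (t - s); rewrite (distrC t) => ? ?.
by rewrite ler_norml; apply/andP; split; lra.
Qed.

Lemma euler_path0 n w : euler_path n w t0 = x0.
Proof. by rewrite /euler_path subrr mulr0 truncn0. Qed.

Lemma euler_bounded w t : t0 <= t -> bounded_fun (fun n => euler_path n w t).
Proof.
move=> tt0; exists (`|x0| + M * (t - t0 + 1)); split; first exact: num_real.
move=> y xy n _; apply: le_trans _ (ltW xy).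
have := euler_path_dist n w tt0 (lexx t0); rewrite euler_path0 => h.
rewrite -(subrK x0 (euler_path _ _ _)).
apply: le_trans (ler_normD _ _) _; rewrite addrC lerD2l.
apply: le_trans h _; rewrite ger0_norm ?subr_ge0//.
have M0 : 0 <= M by exact: le_trans (normr_ge0 _) (slope_bound 0 0).
by rewrite ler_wpM2l// lerD2l invf_le1// ler1n.
Qed.

Lemma euler_limit0 w : euler_limit w t0 = x0.
Proof.
apply/eqP; rewrite eq_le; apply/andP; split.
  apply: limn_sup_le; first exact: euler_bounded.
  by apply: nearW => n; rewrite euler_path0.
apply: limn_sup_ge; first exact: euler_bounded.
by move=> N; exists N => //; rewrite euler_path0.
Qed.

Lemma euler_limit_lipschitz w : M.-lipschitz_`[t0, +oo[ (euler_limit w).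
Proof.
apply/lipschitz_onP => s t /=; rewrite !in_itv/= !andbT => ss0 tt0.
have M0 : 0 <= M by exact: le_trans (normr_ge0 _) (slope_bound 0 0).
suff H s' t' : t0 <= s' -> t0 <= t' ->
    euler_limit w s' - euler_limit w t' <= M * `|s' - t'|.
  by rewrite ler_norml H// andbT lerNl opprB distrC H.
move=> {}ss0 {}tt0; rewrite lerBlDr; apply/ler_addgt0Pr => e e0.
apply: limn_sup_le; first exact: euler_bounded.
have e2 : 0 < e / 2 by rewrite divr_gt0.
have eM : 0 < e / 2 / (M + 1) by rewrite divr_gt0// ltr_wpDl.
near=> n.
have := euler_path_dist n w ss0 tt0.
have : euler_path n w t' < euler_limit w t' + e / 2.
  by near: n; apply: near_lt_limn_supD => //; exact: euler_bounded.
have : M * n.+1%:R^-1 <= e / 2.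
  have : n.+1%:R^-1 < e / 2 / (M + 1) by near: n; exact: near_invn_lt.
  rewrite ltr_pdivlMr ?ltr_wpDl//; have : (0 : R) < n.+1%:R^-1 by [].
  by move: n.+1%:R^-1 => v; nra.
by rewrite ler_norml mulrDr; move: n.+1%:R^-1 => v ? ? /andP[_ ?]; lra.
Unshelve. all: by end_near. Qed.

(** Both orders of [i] and [j] are covered because [euler_limit_step] is applied forwards and
    backwards in time. *)
Lemma euler_const_slope n w i j (c : R) :
  (forall k, (minn i j <= k < maxn i j)%N ->
     slope (euler n w k) (w (t0 + k%:R / n.+1%:R)) = c) ->
  euler n w j = euler n w i + c * (j%:R / n.+1%:R - i%:R / n.+1%:R).
Proof.
wlog ij : i j / (i <= j)%N.
  move=> H; case/orP: (leq_total i j) => [ij|ji] Hc; first exact: H.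
  rewrite (H _ _ ji); first by ring.
  by move=> k kij; apply: Hc; rewrite minnC maxnC.
rewrite (minn_idPl ij) (maxn_idPr ij) -(subnKC ij).
elim: (j - i)%N => [|k IH] Hc; first by rewrite addn0 subrr mulr0 addr0.
rewrite addnS /= Hc ?leq_addr ?addnS//= IH => [|l /andP[il lk]]; last first.
  by apply: Hc; rewrite il addnS ltnS ltnW.
by rewrite -[(i + k).+1%:R]natr1 [(_ + 1) / _]mulrDl mul1r; ring.
Qed.

(** Infinitely many schemes are close to the upper limit at time [s]. Their nodes between [s] and
    [t] stay where the slope is [c], so they follow the line of slope [c] up to a small error, and
    the upper limit at [t] is at least its value. Since [t] may precede [s], exchanging the two
    times gives the converse inequality. *)
Lemma euler_limit_step w s t (c e : R) : t0 <= s -> t0 <= t -> 0 < e ->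
  (forall r y, t0 <= r -> `|r - s| <= `|s - t| + e ->
     `|y - euler_limit w s| <= M * `|s - t| + e -> slope y (w r) = c) ->
  euler_limit w s + c * (t - s) <= euler_limit w t.
Proof.
move=> ss0 tt0 e0 H; apply/ler_addgt0Pr => d d0; rewrite -lerBlDr.
apply: limn_sup_ge => [|N]; first exact: euler_bounded.
have M0 : 0 <= M by exact: le_trans (normr_ge0 _) (slope_bound 0 0).
pose g := Num.min (d / 2) (e / 2).
have g0 : 0 < g by rewrite lt_min !divr_gt0.
(* The divisor lets [g] bound three rounding errors at once: the grid step, its effect [M / (n + 1)]
   on the node values, and its effect on the affine formula, of size |c| over [n + 1]. Two errors
   [g] add up to at most [d] and at most [e], whence the halves in [g]. *)
pose h := g / (M + `|c| + 1).
have Mc0 : 0 < M + `|c| + 1 by rewrite ltr_wpDl// addr_ge0.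
have h0 : 0 < h by rewrite divr_gt0.
have [N1 _ N1h] := near_invn_lt h0.
have [N2 _ N2g] := near_lt_limn_supD (euler_bounded w ss0) g0.
have [n Nn xn] := limn_supB_lt_frequently (euler_bounded w ss0) g0
  (maxn N (maxn N1 N2)).
move: Nn; rewrite !geq_max => /and3P[Nn N1n N2n].
exists n => //.
have {N1h N1n} : n.+1%:R^-1 < h by exact: N1h.
have {N2g N2n} : euler_path n w s < euler_limit w s + g by exact: N2g.
have := truncn_time n ss0; have := truncn_time n tt0.
have n0 : 0 < n.+1%:R^-1 :> R by [].
move: xn H; rewrite /euler_path -/(euler_limit _ _) /=.
set X := euler_limit w s.
set i := Num.truncn (_ * (s - _)); set j := Num.truncn _ => xn H jt is' xs nh.
have hg : (M + `|c| + 1) * n.+1%:R^-1 <= g.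
  by move: (ltW nh); rewrite /h ler_pdivlMr// mulrC.
have gd : g <= d / 2 by rewrite ge_min lexx.
have ge : g <= e / 2 by rewrite ge_min lexx orbT.
have c0 := normr_ge0 c.
have bnd k : (minn i j <= k < maxn i j)%N ->
    `|t0 + k%:R / n.+1%:R - s| <= `|s - t| + e /\
    `|k%:R / n.+1%:R - i%:R / n.+1%:R| <= `|s - t| + n.+1%:R^-1.
  move=> /andP[]; rewrite geq_min leq_max => ijk kij.
  have : (i%:R / n.+1%:R <= k%:R / n.+1%:R :> R) ||
         (j%:R / n.+1%:R <= k%:R / n.+1%:R :> R).
    by rewrite !ler_pM2r// !ler_nat.
  have : (k%:R / n.+1%:R <= i%:R / n.+1%:R :> R) ||
         (k%:R / n.+1%:R <= j%:R / n.+1%:R :> R).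
    by rewrite !ler_pM2r// !ler_nat; case/orP: kij => /ltnW ->//; rewrite orbT.
  move: n0 hg is' jt; move: n.+1%:R^-1 (i%:R / _) (j%:R / _) (k%:R / _).
  move=> v p q r v0 hg /andP[? ?] /andP[? ?] h1 h2.
  have ? : v <= e by nra.
  have := ler_norm (s - t); have := ler_norm (t - s); rewrite (distrC t) => ? ?.
  by rewrite !ler_norml; case/orP: h1 => ?; case/orP: h2 => ?;
    split; apply/andP; split; lra.
rewrite (@euler_const_slope n w i j c) => [|k /bnd[b1' b2']]; last first.
  apply: H => //; first by rewrite lerDl divr_ge0.
  have := euler_dist n w k i.
  have -> : `|k%:R - i%:R| / n.+1%:R = `|k%:R / n.+1%:R - i%:R / n.+1%:R| :> R.
    by rewrite -mulrBl normrM (ger0_norm (ltW n0)).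
  move: b2'; move: xs xn n0 hg; rewrite -/i -/X.
  move: n.+1%:R^-1 (`|k%:R / _ - i%:R / _|) (euler n w i) (euler n w k).
  move=> v p x y ? ? ? ? ?.
  have : M * p <= M * (`|s - t| + v) by exact: ler_wpM2l.
  rewrite !ler_norml mulrDr => ? /andP[? ?].
  have ? : M * v <= g by nra.
  by apply/andP; split; lra.
move: n0 hg is' jt xn; rewrite -/i -/X.
move: n.+1%:R^-1 (i%:R / _) (j%:R / _) (euler n w i).
move=> v p q x v0 hg /andP[? ?] /andP[? ?] ?.
have : `|c * (q - p - (t - s))| <= `|c| * v.
  by rewrite normrM ler_wpM2l// ler_norml; apply/andP; split; lra.
have ? : `|c| * v <= g by nra.
by rewrite ler_norml !mulrBr => /andP[? ?]; lra.
Qed.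

(** Applying [euler_limit_step] from [t] to [u] and from [u] to [t] yields two opposite
    inequalities. *)
Lemma euler_limit_linear w t (c g : R) : t0 <= t -> 0 < g ->
  (forall r y, t0 <= r -> `|r - t| < g -> `|y - euler_limit w t| < g ->
     slope y (w r) = c) ->
  exists2 d, 0 < d & forall u, t0 <= u -> `|u - t| < d ->
     euler_limit w u - euler_limit w t = c * (u - t).
Proof.
move=> tt0 g0 H.
have M0 : 0 <= M by exact: le_trans (normr_ge0 _) (slope_bound 0 0).
(* At most three of the four quarters are used: two for the excursion that [euler_limit_step]
   allows, one for the distance between the two base points. *)
pose e := g / 4; have e0 : 0 < e by rewrite divr_gt0.
pose d := e / (M + 1); have d0 : 0 < d by rewrite divr_gt0// ltr_wpDl.
have dE : d * (M + 1) = e by rewrite divfK// gt_eqF// ltr_wpDl.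
have dM : d * M <= e by rewrite -dE; nra.
have de : d <= e by rewrite -dE; nra.
have ge : g = 4 * e by rewrite mulrC divfK.
exists d => // u tu utd.
have ? : M * `|u - t| <= e by apply: le_trans dM; rewrite mulrC ler_wpM2r// ltW.
have Xut : `|euler_limit w u - euler_limit w t| <= M * `|u - t|.
  have /lipschitz_onP := euler_limit_lipschitz w.
  by apply; rewrite /= in_itv/= andbT.
have : euler_limit w t + c * (u - t) <= euler_limit w u.
  apply: (euler_limit_step tt0 tu e0) => r y rt0; rewrite (distrC t) => ? ?.
  by apply: H => //; lra.
have : euler_limit w u + c * (t - u) <= euler_limit w t.
  apply: (euler_limit_step tu tt0 e0) => r y rt0 ? ?; apply: H => //.
    by have := ler_distD u r t; lra.
  by have := ler_distD (euler_limit w u) y (euler_limit w t); lra.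
by move=> ? ?; apply/eqP; rewrite eq_le; apply/andP; split; lra.
Qed.

(** Off the path [b], continuity makes the slope constant in a neighbourhood of the current point,
    so by [euler_limit_linear] the difference quotient is eventually constant. *)
Lemma euler_limit_solution b : {within `[t0, +oo[, continuous b} ->
  lipschitz_solution b1 b2 x0 b t0 `[t0, +oo[ (euler_limit b).
Proof.
move=> /within_continuous_ballP cb.
have main t c g : t0 <= t -> 0 < g ->
    (forall r y, t0 <= r -> `|r - t| < g -> `|y - euler_limit b t| < g ->
       slope y (b r) = c) ->
    (euler_limit b u - euler_limit b t) / (u - t)
      @[u --> within `[t0, +oo[ t^'] --> c.
  move=> tt0 g0 /(euler_limit_linear tt0 g0)[d d0 Hd].
  apply: cvg_near_cst; rewrite near_withinE near_withinE.
  rewrite -nbhs_ballE; exists d => //= u; rewrite /ball/= distrC => ud ut.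
  rewrite in_itv/= andbT => tu.
  by rewrite Hd// mulfK// subr_eq0.
have cont t e : t0 <= t -> 0 < e -> exists2 d, 0 < d &
    forall r, t0 <= r -> `|r - t| < d -> `|b r - b t| < e.
  move=> tt0 e0; have [|d d0 Hd] := cb t e _ e0; first by rewrite /= in_itv/= tt0.
  exists d => // r rt0 rt; rewrite distrC; apply: Hd.
    by rewrite /= in_itv/= rt0.
  by rewrite /ball/= distrC.
split.
- by exists M; exact: euler_limit_lipschitz.
- exact: euler_limit0.
- move=> t /=; rewrite in_itv/= andbT => tt0 Xb.
  pose e := (b t - euler_limit b t) / 2.
  have e0 : 0 < e by rewrite divr_gt0// subr_gt0.
  have eE : b t - euler_limit b t = 2 * e by rewrite mulrC divfK.
  have [d d0 Hd] := cont t e tt0 e0.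
  apply: (main t b1 (Num.min d e)) => //; first by rewrite lt_min d0.
  move=> r y rt0; rewrite !lt_min => /andP[/(Hd _ rt0) + _] /andP[_ +].
  rewrite !ltr_norml => /andP[? ?] /andP[? ?].
  by rewrite /slope ifT//; lra.
- move=> t /=; rewrite in_itv/= andbT => tt0 Xb.
  pose e := (euler_limit b t - b t) / 2.
  have e0 : 0 < e by rewrite divr_gt0// subr_gt0.
  have eE : euler_limit b t - b t = 2 * e by rewrite mulrC divfK.
  have [d d0 Hd] := cont t e tt0 e0.
  apply: (main t b2 (Num.min d e)) => //; first by rewrite lt_min d0.
  move=> r y rt0; rewrite !lt_min => /andP[/(Hd _ rt0) + _] /andP[_ +].
  rewrite !ltr_norml => /andP[? ?] /andP[? ?].
  by rewrite /slope ifF//; apply/negbTE; rewrite -leNgt; lra.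
Qed.

Lemma measurable_euler (I : set R) n k :
  (forall j, (j < k)%N -> I (t0 + j%:R / n.+1%:R)) ->
  measurable_fun setT ((fun w => euler n w k) : path_space R I -> R).
Proof.
elim: k => [|k IH] H /=; first exact: measurable_cst.
have mk : measurable_fun setT ((fun w => euler n w k) : path_space R I -> R).
  by apply: IH => j jk; apply: H; rewrite ltnS ltnW.
apply: measurable_funD => //.
apply: measurable_funM => //.
apply: measurable_fun_ifT => //.
apply: measurable_fun_ltr => //.
by apply: measurable_coordinate; exact: H.
Qed.

(** Only grid times up to [t] enter, and upper limits preserve measurability. The form with [a] is
    that of the drift to which absolute continuity is applied. *)
Lemma euler_limit_adapted (a : R) :
  adapted t0 (fun t w => a - euler_limit w t).
Proof.
move=> t tt0; apply: measurable_funB => //.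
apply: (@measurable_fun_limn_sup _ (path_space R `[t0, t]) R setT
  (fun n w => euler_path n w t)).
- by move=> w _; exact/bounded_fun_has_ubound/euler_bounded.
- by move=> w _; exact/bounded_fun_has_lbound/euler_bounded.
- move=> n; apply: measurable_euler => j jk /=.
  have /= := truncn_time n tt0; rewrite in_itv/= => /andP[h _].
  rewrite lerDl divr_ge0//= -lerBrDl; apply: le_trans h.
  by rewrite ler_pM2r// ler_nat ltnW.
Qed.

End euler.

(** * Small occupation of a level, expressed by Riemann sums *)

Section occupation.
Variables (R : realType) (t0 : R).
Implicit Types (w : R -> R) (c e : R) (n i N j k m p : nat).

Definition mesh_point n i N j : R :=
  t0 + (i%:R + j%:R / N.+1%:R) / n.+1%:R.

(* A Riemann sum for the time that w spends at distance less than e from c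
   during [t0 + i / (n + 1), t0 + (i + 1) / (n + 1)]. Riemann sums are
   measurable functionals of the path, unlike the occupation time itself. *)
Definition occupation_sum c e n i N w : R :=
  \sum_(j < N.+1) (`|w (mesh_point n i N j) - c| < e)%R%:R
    / (N.+1%:R * n.+1%:R).

(** The factor [k.+1%:R^-1] is the o(1) of the occupation estimate on cells of length [1 / (n + 1)];
    it is uniform in the dyadic scale [m], while [N0] may depend on [m]. All quantifiers range over
    integers, which keeps the set measurable. The radius is twice the scale so as to absorb the
    oscillation between mesh points. *)
Definition small_occupation c p : set (R -> R) :=
  [set w | forall k, exists2 n, (k <= n)%N &
     forall i, (i < p * n.+1)%N -> forall m,
     exists N0, forall N, (N0 <= N)%N ->
       occupation_sum c (2 * 2^-1 ^+ m) n i N w <= 2^-1 ^+ m / k.+1%:R].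

Lemma mesh_pointS n i N j :
  mesh_point n i N j.+1 = mesh_point n i N j + (N.+1%:R * n.+1%:R)^-1.
Proof.
have [n0 N0] : n.+1%:R != 0 :> R /\ N.+1%:R != 0 :> R by rewrite !pnatr_eq0.
rewrite /mesh_point -[j.+1%:R]natr1.
by move: n.+1%:R N.+1%:R n0 N0 => x y x0 y0; field; rewrite x0.
Qed.

Lemma mesh_point0 n i N : mesh_point n i N 0 = t0 + i%:R / n.+1%:R.
Proof. by rewrite /mesh_point mul0r addr0. Qed.

Lemma mesh_point_last n i N :
  mesh_point n i N N.+1 = t0 + i.+1%:R / n.+1%:R.
Proof. by rewrite /mesh_point divff ?pnatr_eq0// natr1. Qed.

Lemma mesh_point_itv p n i N j : (i < p * n.+1)%N -> (j <= N.+1)%N ->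
  mesh_point n i N j \in `[t0, t0 + p%:R].
Proof.
move=> ip jN; rewrite in_itv/=; apply/andP; split.
  by rewrite lerDl divr_ge0// addr_ge0// divr_ge0.
rewrite lerD2l ler_pdivrMr// -natrM; apply: (@le_trans _ _ (i%:R + 1)).
  by rewrite lerD2l ler_pdivrMr// mul1r ler_nat.
by rewrite natr1 ler_nat.
Qed.

End occupation.

Lemma expr_half_lt (R : realType) (e : R) : 0 < e -> exists m, 2^-1 ^+ m < e.
Proof.
move=> /near_invn_lt[m _ /(_ m (leqnn m)) me]; exists m.+1.
apply: lt_trans me; rewrite exprVn ltf_pV2 ?posrE ?exprn_gt0//.
by rewrite -natrX ltr_nat ltn_expl.
Qed.

(** * Uniqueness for a path with small occupation *)

Section uniqueness.
Variables (R : realType) (b1 b2 x0 t0 : R) (b X Y : R -> R).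

Lemma lipschitz_solutionW (I J : set R) : J `<=` I ->
  lipschitz_solution b1 b2 x0 b t0 I X -> lipschitz_solution b1 b2 x0 b t0 J X.
Proof.
move=> JI [[K /lipschitz_onP KX] X0 lt gt]; split => //.
- by exists K; apply/lipschitz_onP => x y /JI Ix /JI Iy; exact: KX.
- move=> t Jt Xt; apply: cvg_trans (lt t (JI _ Jt) Xt).
  by apply: cvg_app; apply: within_subset => // u /=; exact: JI.
- move=> t Jt Xt; apply: cvg_trans (gt t (JI _ Jt) Xt).
  by apply: cvg_app; apply: within_subset => // u /=; exact: JI.
Qed.

Variable T : R.
Let I : set R := `[t0, T].

Hypotheses (solX : lipschitz_solution b1 b2 x0 b t0 I X)
           (solY : lipschitz_solution b1 b2 x0 b t0 I Y).

Let D t := Y t - X t.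

Lemma difference_lipschitz : exists2 C, 0 <= C &
  forall s t, I s -> I t -> `|D s - D t| <= C * `|s - t|.
Proof.
have [[K1 /lipschitz_onP KX] _ _ _] := solX.
have [[K2 /lipschitz_onP KY] _ _ _] := solY.
exists (`|K1| + `|K2|); first by rewrite addr_ge0.
move=> s t Is It; have -> : D s - D t = (Y s - Y t) - (X s - X t).
  by rewrite /D; ring.
apply: le_trans (ler_normB _ _) _; rewrite mulrDl addrC.
by apply: lerD; [apply: le_trans (KX _ _ Is It) _|
  apply: le_trans (KY _ _ Is It) _]; rewrite ler_wpM2r// ler_norm.
Qed.

(* Off the set where b lies between X and Y both solutions have the same
   derivative. *)
Lemma difference_derive t : t0 < t < T -> `|D t| < `|b t - X t| ->
  is_derive t 1 D 0.
Proof.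
move=> /andP[tt0 tT] Db.
have It : I t by rewrite /I/= in_itv/= !ltW.
have [c [cX cY]] : exists c : R,
    ((X u - X t) / (u - t) @[u --> within I t^'] --> c) /\
    ((Y u - Y t) / (u - t) @[u --> within I t^'] --> c).
  have [_ _ ltX gtX] := solX; have [_ _ ltY gtY] := solY.
  (* The bound on [D t] puts [X t] and [Y t] strictly on the same side of [b t]; the case of a tie
     would make an absolute value negative. *)
  move: Db; rewrite /D; case: (ltrgtP (X t) (b t)) => Xb.
  - rewrite ltr_norml => /andP[_ ?].
    exists b1; split; first exact: ltX.
    by apply: ltY => //; lra.
  - rewrite ltr_norml => /andP[? _].
    exists b2; split; first exact: gtX.
    by apply: gtY => //; lra.
  - by rewrite ltNge normr_ge0.
apply/is_derive1_caratheodory.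
(* At [z = t] the convention 0 / 0 = 0 gives precisely the derivative claimed. *)
exists (fun z => (D z - D t) / (z - t)); split; last by rewrite subrr mul0r.
  move=> z; have [->|zt] := eqVneq z t; first by rewrite !subrr mulr0.
  by rewrite divfK// subr_eq0.
apply/cvgrPdist_lt => e e0; rewrite !subrr mul0r.
have : (Y u - Y t) / (u - t) - (X u - X t) / (u - t)
    @[u --> within I t^'] --> c - c by exact: cvgB.
move/cvgrPdist_lt => /(_ _ e0); rewrite subrr !near_withinE => H.
(* As [t] is interior, limits within [I] are two-sided limits. *)
have nI : \forall u \near t, I u.
  have : \forall u \near t, u \in `]t0, T[.
    by apply: near_in_itvoo; rewrite in_itv/= tt0.
  apply: filterS => u; rewrite /I/= !in_itv/= => /andP[? ?].
  by apply/andP; split; exact: ltW.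
near=> u.
have [->|ut] := eqVneq u t; first by rewrite !subrr mul0r subrr normr0.
have -> : (D u - D t) / (u - t) =
    (Y u - Y t) / (u - t) - (X u - X t) / (u - t).
  by rewrite /D -mulrBl; congr (_ / _); ring.
have Iu : I u by near: u.
move: ut Iu; near: u; exact: H.
Unshelve. all: by end_near. Qed.

Lemma difference_constant s t : I s -> I t -> s <= t ->
  (forall r, s <= r <= t -> `|D r| < `|b r - X r|) -> D s = D t.
Proof.
move=> Is It st H; have [C C0 DC] := difference_lipschitz.
have sI r : s <= r <= t -> I r.
  move: Is It; rewrite /I/= !in_itv/= => /andP[? ?] /andP[? ?] /andP[? ?].
  by apply/andP; split; lra.
have [||r _] := @MVT_segment _ D (fun=> 0) s t st.
- move=> r; rewrite in_itv/= => /andP[sr rt]; apply: difference_derive.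
    move: Is It; rewrite /I/= !in_itv/= => /andP[? ?] /andP[? ?].
    by apply/andP; split; lra.
  by apply: H; rewrite !ltW.
- apply: (@lipschitz_within_continuous _ C) => r u.
  by rewrite /= !in_itv/= => /sI Ir /sI Iu; exact: DC.
- by rewrite mul0r => /eqP; rewrite subr_eq0 => /eqP.
Qed.

(** [D] can move only on submesh intervals whose left end has [b - X] within [2 * e] of 0. On the
    others [b - X] stays above [e] in absolute value, hence above [D], and [D] is constant. Each
    interval that counts contributes at most [C] times its length. *)
Lemma difference_cell (n i N : nat) (C e : R) : 0 <= C ->
  (forall s t, I s -> I t -> `|D s - D t| <= C * `|s - t|) ->
  (forall j, (j <= N.+1)%N -> I (mesh_point t0 n i N j)) ->
  D (mesh_point t0 n i N 0) = 0 ->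
  (forall r, mesh_point t0 n i N 0 <= r <= mesh_point t0 n i N N.+1 ->
     `|D r| <= e) ->
  (forall r s, I r -> I s -> `|r - s| <= (N.+1%:R * n.+1%:R)^-1 ->
     `|(b r - X r) - (b s - X s)| < e) ->
  forall t, mesh_point t0 n i N 0 <= t <= mesh_point t0 n i N N.+1 ->
    `|D t| <= C * occupation_sum t0 0 (2 * e) n i N (fun t => b t - X t).
Proof.
have [h hE] : exists h : R, h = (N.+1%:R * n.+1%:R)^-1 by eexists.
have meshS l : mesh_point t0 n i N l.+1 = mesh_point t0 n i N l + h.
  by rewrite mesh_pointS hE.
rewrite /occupation_sum -hE => C0 DC meshI D0 De osc.
pose F j := (`|b (mesh_point t0 n i N j) - X (mesh_point t0 n i N j) - 0|
  < 2 * e)%R%:R * h : R.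
have h0 : 0 < h by rewrite hE invr_gt0 mulr_gt0.
have F0 j : 0 <= F j by rewrite mulr_ge0// ltW.
suff H j : (j <= N.+1)%N -> forall t,
    mesh_point t0 n i N 0 <= t <= mesh_point t0 n i N j ->
    `|D t| <= C * \sum_(l < j) F l by exact: H.
have mesh_mono l k : (l <= k)%N -> mesh_point t0 n i N l <= mesh_point t0 n i N k.
  move=> /subnKC <-; elim: (k - l)%N => [|a IH]; first by rewrite addn0.
  by rewrite addnS meshS (le_trans IH)// lerDl ltW.
elim: j => [_ t|j IH jN t /andP[t1 t2]].
  by move=> /le_anti <-; rewrite D0 normr0 big_ord0 mulr0.
rewrite big_ord_recr/= mulrDr.
have {}IH := IH (ltnW jN).
case: (lerP t (mesh_point t0 n i N j)) => tj.
  by apply: le_trans (IH _ _) _; rewrite ?t1// lerDl mulr_ge0.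
have It : I t.
  have := meshI _ (leqnn N.+1); have := meshI _ (leq0n N.+1).
  have := mesh_mono _ _ jN.
  rewrite /I/= !in_itv/= => ? /andP[? ?] /andP[? ?].
  by apply/andP; split; lra.
have Ij := meshI _ (ltnW jN).
have DtDj : `|D t - D (mesh_point t0 n i N j)| <= C * F j.
  rewrite meshS in t2; rewrite /F; case: (boolP (_ < 2 * e)) => [_|]/=.
    rewrite mul1r; apply: le_trans (DC _ _ It Ij) _.
    by rewrite ler_wpM2l// ger0_norm; lra.
  rewrite -leNgt subr0 => uj.
  rewrite (difference_constant Ij It (ltW tj)).
    by rewrite subrr normr0 mul0r mulr0.
  move=> r /andP[rj rt].
  have Ir : I r.
    move: It Ij; rewrite /I/= !in_itv/= => /andP[? ?] /andP[? ?].
    by apply/andP; split; lra.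
  apply: le_lt_trans (De r _) _.
    have := mesh_mono _ _ (leq0n j); have := mesh_mono _ _ jN.
    by rewrite meshS => ? ?; apply/andP; split; lra.
  have := osc _ _ Ij Ir; rewrite ler0_norm ?subr_le0// => H.
  have {H} : `|b (mesh_point t0 n i N j) - X (mesh_point t0 n i N j)
     - (b r - X r)| < e by apply: H; lra.
  by have := lerB_dist (b (mesh_point t0 n i N j) - X (mesh_point t0 n i N j))
    (b r - X r); lra.
have := IH (mesh_point t0 n i N j); rewrite lexx andbT => /(_ (mesh_mono _ _ (leq0n j))).
by have := lerB_dist (D t) (D (mesh_point t0 n i N j)); lra.
Qed.

End uniqueness.

(** The outer induction goes over the cells and carries the vanishing of the difference to the next
    left end. Within a cell, an inner induction on [m] halves the bound at each turn by
    [difference_cell]. *)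
Lemma small_occupation_unique (R : realType) (b1 b2 x0 t0 : R) (b X Y : R -> R)
    (p : nat) (I := `[t0, t0 + p%:R]%classic) :
  {within I, continuous b} ->
  lipschitz_solution b1 b2 x0 b t0 I X ->
  lipschitz_solution b1 b2 x0 b t0 I Y ->
  small_occupation t0 0 p (fun t => b t - X t) ->
  {in I, Y =1 X}.
Proof.
move=> cb solX solY occ.
have [C C0 DC] := difference_lipschitz solX solY.
(* This index serves twice: [2 * C < k + 1] gives the halving, and [2 * C < n + 1] makes the
   difference at most 1 on a cell, which starts the inner induction. *)
have [n Cn {}occ] := occ (Num.truncn (2 * C)).
have {}Cn : 2 * C < n.+1%:R.
  apply: lt_le_trans (truncnS_gt _) _; by rewrite ler_nat ltnS.
have [[K /lipschitz_onP KX] X0 _ _] := solX; have [_ Y0 _ _] := solY.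
have cu : {within I, continuous (fun t => b t - X t)}.
  by apply: within_continuousB => //; exact: lipschitz_within_continuous KX.
suff H i : (i <= p * n.+1)%N -> forall t,
    t0 <= t <= t0 + i%:R / n.+1%:R -> Y t - X t = 0.
  move=> t /set_mem; rewrite /I/= in_itv/= => tI; apply/eqP; rewrite -subr_eq0.
  by rewrite (H _ (leqnn _))// natrM mulfK// pnatr_eq0.
elim: i => [_ t|i IH ip t /andP[t1 t2]].
  by rewrite mul0r addr0 => /le_anti <-; rewrite X0 Y0 subrr.
case: (lerP t (t0 + i%:R / n.+1%:R)) => ti.
  by apply: IH; [exact: ltnW|rewrite t1].
have mI N j : (j <= N.+1)%N -> I (mesh_point t0 n i N j).
  by move=> jN; exact: mesh_point_itv.
have n0 : 0 < n.+1%:R^-1 :> R by [].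
have stp : i.+1%:R / n.+1%:R = i%:R / n.+1%:R + n.+1%:R^-1 :> R.
  by rewrite -[i.+1%:R]natr1 mulrDl mul1r.
have Dq : Y (t0 + i%:R / n.+1%:R) - X (t0 + i%:R / n.+1%:R) = 0.
  by apply: IH; [exact: ltnW|rewrite lexx lerDl divr_ge0].
suff main m : forall r, t0 + i%:R / n.+1%:R <= r <= t0 + i.+1%:R / n.+1%:R ->
    `|Y r - X r| <= 2^-1 ^+ m.
  apply: contrapT => /eqP; rewrite -normr_gt0 => /expr_half_lt[m].
  by rewrite ltNge main// t2 ltW.
elim: m => [|m IHm] r /andP[r1 r2].
  have Iq : I (t0 + i%:R / n.+1%:R) by rewrite -(mesh_point0 _ _ _ 0); exact: mI.
  have Ir : I r.
    have := mI 0 1%N isT; move: Iq; rewrite mesh_point_last /I/= !in_itv/=.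
    move: (i%:R / _) (i.+1%:R / _) r1 r2 => q q' ? ? /andP[? ?] /andP[? ?].
    by apply/andP; split; lra.
  have := DC _ _ Ir Iq; rewrite Dq subr0 expr0 => /le_trans; apply.
  rewrite ger0_norm ?subr_ge0//.
  have : C * (r - (t0 + i%:R / n.+1%:R)) <= C * n.+1%:R^-1.
    apply: ler_wpM2l => //; move: r2; rewrite stp.
    by move: n.+1%:R^-1 (i%:R / _) => v q; lra.
  move=> /le_trans; apply; rewrite ler_pdivrMr// mul1r.
  lra.
have [N0 occN] := occ i ip m.
have e0 : 0 < 2^-1 ^+ m :> R by rewrite exprn_gt0.
have [d d0 ud] := compact_within_unif_continuous (@segment_compact _ _ _) cu e0.
have [N1 _ N1d] := near_invn_lt d0.
pose N := maxn N0 N1.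
have := @difference_cell _ _ _ _ _ _ _ _ _ solX solY n i N C (2^-1 ^+ m) C0 DC (mI N).
rewrite mesh_point0 mesh_point_last => /(_ Dq IHm) h.
apply: le_trans (h _ r _) _; last 2 first.
- by rewrite r1.
- apply: le_trans (ler_wpM2l C0 (occN N (leq_maxl _ _))) _.
  rewrite exprS mulrA ler_pdivrMr// [leRHS]mulrAC; apply: ler_wpM2r; first exact: ltW.
  by have := truncnS_gt (2 * C); lra.
- move=> s s' Is Is' ss'; apply: ud => //; rewrite /ball/=.
  apply: le_lt_trans ss' _; apply: le_lt_trans (N1d N (leq_maxr _ _)).
  by rewrite lef_pV2 ?posrE ?mulr_gt0// ler_peMr// ler1n.
Qed.

(** * Measurability and translation of the small occupation event *)

Lemma measurable_forall d (T : measurableType d) (a : set nat)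
    (P : nat -> set T) : (forall n, a n -> measurable (P n)) ->
  measurable [set x | forall n, a n -> P n x].
Proof.
move=> mP; have [->|/set0P a0] := eqVneq a set0.
  rewrite (_ : [set _ | _] = setT)//.
  by apply/seteqP; split => // x _ n [].
by apply: bigcap_measurable.
Qed.

Lemma measurable_exists d (T : measurableType d) (a : set nat)
    (P : nat -> set T) : (forall n, a n -> measurable (P n)) ->
  measurable [set x | exists2 n, a n & P n x].
Proof. by move=> mP; apply: bigcup_measurable. Qed.

Lemma measurable_occupation_sum (R : realType) (t0 c e : R) (I : set R) n i N :
  (forall j, (j <= N)%N -> I (mesh_point t0 n i N j)) ->
  measurable_fun setT (occupation_sum t0 c e n i N : path_space R I -> R).
Proof.
move=> HI; apply: measurable_sum => j; apply: measurable_funM => //.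
rewrite (_ : (fun _ => _) = fun w : path_space R I =>
    if `|w (mesh_point t0 n i N j) - c| < e then 1 else 0 : R); last first.
  by apply/funext => w; case: ifP.
apply: measurable_fun_ifT => //; apply: measurable_fun_ltr => //.
apply: measurableT_comp => //; apply: measurable_funB => //.
by apply: measurable_coordinate; apply: HI; rewrite -ltnS.
Qed.

Lemma measurable_small_occupation (R : realType) (t0 c : R) p (I : set R) :
  `[t0, t0 + p%:R] `<=` I ->
  measurable (small_occupation t0 c p : set (path_space R I)).
Proof.
move=> pI; rewrite /small_occupation.
rewrite (_ : [set _ | _] = [set w : path_space R I | forall k, setT k ->
   exists2 n, (k <= n)%N & forall i, (i < p * n.+1)%N -> forall m, setT m ->
     exists2 N0, setT N0 & forall N, (N0 <= N)%N ->
     occupation_sum t0 c (2 * 2^-1 ^+ m) n i N w <= 2^-1 ^+ m / k.+1%:R]).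
  apply: measurable_forall => k _; apply: measurable_exists => n kn.
  apply: measurable_forall => i ip; apply: measurable_forall => m _.
  apply: measurable_exists => N0 _; apply: measurable_forall => N _.
  rewrite -[X in measurable X]setTI.
  apply: measurable_fun_le => //.
  apply: measurable_occupation_sum => j jN; apply: pI.
  by apply: mesh_point_itv => //; exact: leqW.
apply/seteqP; split => w H k.
  move=> _; have [n kn {}H] := H k; exists n => // i ip m _.
  by have [N0 {}H] := H i ip m; exists N0.
have [n kn {}H] := H k Logic.I; exists n => // i ip m.
by have [N0 _ {}H] := H i ip m Logic.I; exists N0.
Qed.

Lemma small_occupationD (R : realType) (t0 c a : R) p (w : R -> R) :
  small_occupation t0 (c + a) p (fun t => w t + a) <-> small_occupation t0 c p w.
Proof.
have E e n i N : occupation_sum t0 (c + a) e n i N (fun t => w t + a) =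
    occupation_sum t0 c e n i N w.
  by apply: eq_bigr => j _; rewrite opprD addrACA subrr addr0.
by split=> H k; have [n kn {}H] := H k; exists n => // i ip m;
  have [N0 {}H] := H i ip m; exists N0 => N /H; rewrite E.
Qed.

(** * Transfer of null events between drifts *)

Section absolute_continuity_transfer.
Context (R : realType) d (T : measurableType d) (P : probability T R).
Variables (B : R -> {RV P >-> R}) (t0 x0 : R).
Variable Px : R.-pker R ~> path_space R `[t0, +oo[.
Hypothesis PxB : conditional_path_law B Px.

(** The probability is the integral of the nonnegative function [Px x D]. This links events under
    [P] to the laws [Px x], for which absolute continuity is assumed. *)
Lemma conditional_path_law_null (D : set (path_space R `[t0, +oo[)) :
  measurable D -> P [set w | D (B ^~ w)] = 0%E <->
  {ae distribution P (B t0), forall x, Px x D = 0%E}.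
Proof.
move=> mD; have := PxB.2 setT D measurableT mD.
rewrite (_ : [set w | _ /\ _] = [set w | D (B ^~ w)]); last first.
  by apply/seteqP; split=> [w []|w].
move=> ->.
have mPx : measurable_fun setT (fun x => Px x D) by exact: measurable_kernel.
rewrite (eq_integral (fun x => `|Px x D|)%E); last first.
  by move=> x _; rewrite gee0_abs.
rewrite (ae_eq_integral_abs _ measurableT mPx); split.
  by apply: filterS => x /(_ Logic.I).
by apply: filterS => x xD _.
Qed.

Lemma measurable_path_shift (A : R -> (R -> R) -> R) (J : set R) :
  J `<=` `[t0, +oo[ -> adapted t0 A ->
  measurable_fun setT ((fun w t => w t + A t w) :
    path_space R `[t0, +oo[ -> path_space R J).
Proof.
move=> JI adA; apply: measurable_fun_path => t Jt.
have tt0 : t0 <= t by have := JI t Jt; rewrite /= in_itv/= andbT.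
apply: measurable_funD; first by apply: measurable_coordinate; exact: JI.
(* Adaptedness concerns the coarser path space over [[t0, t]]; the identity map into it is
   measurable. *)
apply: (@measurableT_comp _ _ _ (path_space R `[t0, +oo[) (path_space R `[t0, t])
  _ (A t) _ (fun w => w)); first exact: adA.
apply: measurable_fun_path => s; rewrite /= in_itv/= => /andP[ts _].
by apply: measurable_coordinate; rewrite /= in_itv/= ts.
Qed.

(** The assumption compares shifted paths under [Px x] with paths under [Px (x + x0)], but almost
    every [x] need not mean almost every [x + x0]. The constant drift [x0] bridges this: at the same
    [x], both shifted laws are compared with [Px (x + x0)]. *)
Lemma shifted_path_null (A : R -> (R -> R) -> R) (M s : R)
    (N : set (path_space R `[t0, t0 + s])) :
  lipschitz_shift_equivalence x0 Px -> 0 < s -> measurable N ->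
  adapted t0 A -> (forall w, A t0 w = x0) ->
  (forall w, M.-lipschitz_(`[t0, +oo[) (A ^~ w)) ->
  P [set w | N (fun t => B t w + x0)] = 0%E ->
  P [set w | N (fun t => B t w + A t (B ^~ w))] = 0%E.
Proof.
move=> equiv s0 mN adA A0 lipA.
have JI : `[t0, t0 + s] `<=` `[t0, +oo[.
  by move=> t; rewrite /= !in_itv/= => /andP[-> _].
have mA := measurable_path_shift JI adA.
have adc : adapted t0 (fun _ _ => x0) by move=> t _; exact: measurable_cst.
have mc := measurable_path_shift JI adc.
have mNA := mA measurableT _ mN; rewrite setTI in mNA.
have mNc := mc measurableT _ mN; rewrite setTI in mNc.
move=> /(conditional_path_law_null mNc) H; apply/(conditional_path_law_null mNA).
move: H; apply: filterS => x Nc0.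
have lipc (w : R -> R) : (0 : R).-lipschitz_(`[t0, +oo[) (fun=> x0).
  by apply/lipschitz_onP => ? ? _ _; rewrite subrr normr0 mul0r.
have [_ cst_dom] := equiv (fun _ _ => x0) 0 adc (fun=> erefl) lipc x s s0.
have [A_dom _] := equiv A M adA A0 lipA x s s0.
apply: (A_dom N) => //; apply: cst_dom => N' mN' N'N.
apply/eqP; rewrite /pushforward eq_le measure_ge0 andbT -Nc0.
apply: le_measure; rewrite ?inE//; last by move=> w; exact: N'N.
by have := mc measurableT _ mN'; rewrite setTI.
Qed.

End absolute_continuity_transfer.

(** * From local time to small occupation *)

Section occupation_time.
Variables (R : realType) (b : R -> R).
Hypothesis cb : {within `[0, +oo[, continuous b}.

Let mu := @lebesgue_measure R.

(** The radius is the [2 * 2^-1 ^+ m] of the Riemann sums plus one [2^-1 ^+ m] for the oscillation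
    of [b] over a submesh interval. *)
Definition window (c : R) (m : nat) : set R :=
  `[c - 3 * 2^-1 ^+ m, c + 3 * 2^-1 ^+ m].

Definition occupation_time (S : set R) (t : R) : \bar R :=
  (\int[mu]_(s in `[0%R, t]) (\1_S (b s) : R)%:E)%E.

Lemma measurable_occupied (S I : set R) : measurable S -> measurable I ->
  I `<=` `[0, +oo[ -> measurable_fun I (fun s => (\1_S (b s) : R)%:E).
Proof.
move=> mS mI I0; apply/measurable_EFinP.
apply: (@measurableT_comp _ _ _ _ _ _ (\1_S : R -> R)) => //.
apply: measurable_funS I0 _ => //.
exact: subspace_continuous_measurable_fun.
Qed.

Lemma occupation_timeD S r t : measurable S -> 0 <= r <= t ->
  (occupation_time S t = occupation_time S r +
    \int[mu]_(s in `]r, t]) (\1_S (b s) : R)%:E)%E.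
Proof.
move=> mS /andP[r0 rt].
have I0 : `[0, t] `<=` `[0, +oo[.
  by move=> s; rewrite /= !in_itv/= => /andP[-> _].
have E : `[0, t]%classic = `[0, r] `|` `]r, t].
  by rewrite (@itv_bndbnd_setU _ _ _ (BRight r)) ?bnd_simp.
rewrite /occupation_time E ge0_integral_setU//=.
- by rewrite -E; exact: measurable_occupied.
- by apply/disj_setPS => s; rewrite /= !in_itv/= => -[/andP[_ ?] /andP[]]; lra.
Qed.

(** For a fine submesh, an interval counted by the sum is spent entirely in the window, so its
    length is part of the occupation time. Adding on the left avoids subtracting extended reals. *)
Lemma occupation_sum_le (t0 c : R) (m n i p : nat) : 0 <= t0 ->
  (i < p * n.+1)%N ->
  exists N0, forall N, (N0 <= N)%N ->
  (occupation_time (window c m) (t0 + i%:R / n.+1%:R) +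
     (occupation_sum t0 c (2 * 2^-1 ^+ m) n i N b)%:E <=
   occupation_time (window c m) (t0 + i.+1%:R / n.+1%:R))%E.
Proof.
move=> t00 ip.
have e0 : 0 < 2^-1 ^+ m :> R by rewrite exprn_gt0.
have cb' : {within `[t0, t0 + p%:R], continuous b}.
  apply: continuous_subspaceW cb => s; rewrite /= !in_itv/= andbT => /andP[? _].
  exact: le_trans t00 _.
have [d d0 bd] := compact_within_unif_continuous (@segment_compact _ _ _) cb' e0.
have [N0 _ N0d] := near_invn_lt d0.
exists N0 => N NN0; set S := window c m.
have mS : measurable S by exact: measurable_itv.
have [h hE] : exists h : R, h = (N.+1%:R * n.+1%:R)^-1 by eexists.
have h0 : 0 < h by rewrite hE invr_gt0 mulr_gt0.
have hd : h < d.
  apply: le_lt_trans (N0d N NN0).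
  by rewrite hE lef_pV2 ?posrE ?mulr_gt0// ler_peMr// ler1n.
have meshS l : mesh_point t0 n i N l.+1 = mesh_point t0 n i N l + h.
  by rewrite mesh_pointS hE.
rewrite -(mesh_point0 _ _ _ N) -(mesh_point_last _ _ _ N) /occupation_sum -hE.
suff H j : (j <= N.+1)%N ->
    (occupation_time S (mesh_point t0 n i N 0) +
     (\sum_(l < j) (`|b (mesh_point t0 n i N l) - c| < 2 * 2^-1 ^+ m)%R%:R * h)%:E
    <= occupation_time S (mesh_point t0 n i N j))%E by exact: H.
elim: j => [|j IH] jN; first by rewrite big_ord0 adde0.
rewrite big_ord_recr/= EFinD addeA.
apply: le_trans (leeD2r _ (IH (ltnW jN))) _.
have mI := mesh_point_itv t0 ip (ltnW jN).
have mI' := mesh_point_itv t0 ip jN.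
rewrite meshS in mI' *.
set r := mesh_point t0 n i N j in mI mI' *.
have r0 : 0 <= r by move: mI; rewrite in_itv/= => /andP[? _]; exact: le_trans t00 _.
rewrite (@occupation_timeD S r (r + h))//; last by rewrite r0 lerDl ltW.
apply: leeD2l; case: (boolP (_ < _)) => [rc|_]/=; last first.
  by rewrite mul0r integral_ge0// => s _; rewrite lee_fin.
rewrite mul1r (eq_integral (cst 1%E)) ?integral_cst//=; last first.
  move=> s; rewrite inE/= in_itv/= => /andP[rs sr].
  rewrite indicE mem_set// /S/window/= in_itv/=.
  have : `|b r - b s| < 2^-1 ^+ m.
    apply: bd => //=.
      by move: mI mI'; rewrite !in_itv/= => /andP[? ?] /andP[? ?];
        apply/andP; split; lra.
    by rewrite /ball/= ltr_norml; apply/andP; split; lra.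
  move: rc; rewrite !ltr_norml => /andP[? ?] /andP[? ?].
  by apply/andP; split; lra.
rewrite mul1e /mu lebesgue_measure_itv/= lte_fin ltrDl h0.
by rewrite -EFinD lee_fin; lra.
Qed.

(** The time spent in a window during a cell is the integral over the window of the increment of
    [L]. By uniform continuity this increment is small for all levels at once, so the integral is
    small relative to the width of the window. *)
Lemma local_time_small_occupation (t0 c : R) (L : R -> R -> R) p : 0 <= t0 ->
  {within [set tx : R * R | 0 <= tx.1], continuous (fun tx => L tx.1 tx.2)} ->
  (forall n i m,
     (\int[mu]_x (\1_(window c m) x * L (t0 + i%:R / n.+1%:R) x)%:E =
      occupation_time (window c m) (t0 + i%:R / n.+1%:R))%E) ->
  small_occupation t0 c p b.
Proof.
move=> t00 cL LE k.
(* Radius 3 contains the windows of all scales, as [2^-1 ^+ m <= 1]. *)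
pose K := (`[t0, t0 + p%:R] `*` `[c - 3, c + 3])%classic : set (R * R).
have cK : compact K by apply: compact_setX; exact: segment_compact.
have cLK : {within K, continuous (fun tx => L tx.1 tx.2)}.
  apply: continuous_subspaceW cL => -[t x] [/=]; rewrite in_itv/= => /andP[? _] _.
  exact: le_trans t00 _.
(* The window has length [6 * 2^-1 ^+ m], so this increment integrates to [2^-1 ^+ m / k.+1%:R]. *)
have e0 : 0 < (6 * k.+1%:R)^-1 :> R by rewrite invr_gt0 mulr_gt0.
have [d d0 Ld] := compact_within_unif_continuous cK cLK e0.
have [N1 _ N1d] := near_invn_lt d0.
exists (maxn k N1); first exact: leq_maxl.
set n := maxn k N1 => i ip m.
have [N0 N0le] := occupation_sum_le c m t00 ip.
exists N0 => N /N0le.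
have := LE n i m; have := LE n i.+1 m.
set S := window c m; set q := t0 + i%:R / _; set q' := t0 + i.+1%:R / _.
have n0 : 0 < n.+1%:R^-1 :> R by [].
have qq' : q' = q + n.+1%:R^-1.
  by rewrite /q /q' -[i.+1%:R]natr1 [(_ + 1) / _]mulrDl mul1r addrA.
have mS : measurable S by exact: measurable_itv.
have indE (f : R -> R) :
    (\int[mu]_x (\1_S x * f x)%:E = \int[mu]_(x in S) (f x)%:E)%E.
  rewrite [RHS]integral_mkcond; apply: eq_integral => x _.
  rewrite /patch indicE; case: (x \in S); first by rewrite mul1r.
  by rewrite mul0r.
rewrite !indE => <- <-.
have cS t : 0 <= t -> mu.-integrable S (EFin \o L t).
  move=> t0'; apply: continuous_compact_integrable; first exact: segment_compact.
  apply/within_continuous_ballP => x e _ ex0.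
  move/within_continuous_ballP : cL => /(_ (t, x) e t0' ex0)[a a0 La].
  by exists a => // y _ xy; apply: (La (t, y)) => //; split => //=; exact: ballxx.
(* For [N = 0] the mesh points 0 and 1 are the two ends of the cell. *)
have qK : t0 <= q <= t0 + p%:R.
  have := @mesh_point_itv R t0 p n i 0 0 ip isT.
  by rewrite mesh_point0 in_itv.
have q'K : t0 <= q' <= t0 + p%:R.
  have := @mesh_point_itv R t0 p n i 0 1 ip isT.
  by rewrite mesh_point_last in_itv.
have q0 : 0 <= q by case/andP: qK => ? _; exact: le_trans t00 _.
have q'0 : 0 <= q' by case/andP: q'K => ? _; exact: le_trans t00 _.
have em0 : 0 < 2^-1 ^+ m :> R by rewrite exprn_gt0.
have em1 : 2^-1 ^+ m <= 1 :> R by rewrite exprn_ile1// invf_le1// ler1n.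
have muS : mu S = (6 * 2^-1 ^+ m)%:E.
  rewrite /mu /S /window lebesgue_measure_itv/= lte_fin ifT; last by lra.
  by rewrite -EFinD; congr EFin; lra.
have : (\int[mu]_(x in S) (L q' x)%:E <= \int[mu]_(x in S) (L q x)%:E +
     (2^-1 ^+ m / k.+1%:R)%:E)%E.
  have -> : (2^-1 ^+ m / k.+1%:R)%:E =
      (\int[mu]_(x in S) ((6 * k.+1%:R)^-1)%:E)%E.
    transitivity (((6 * k.+1%:R)^-1)%:E * mu S)%E; last by rewrite integral_cst.
    rewrite muS -EFinM; congr EFin.
    have : k.+1%:R != 0 :> R by rewrite pnatr_eq0.
    by move: k.+1%:R (2^-1 ^+ m) => v f v0; field.
  have cst_int : mu.-integrable S (fun=> ((6 * k.+1%:R)^-1)%:E).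
    apply/integrableP; split; first exact: measurable_cst.
    rewrite integral_cst//= [X in (_ * X)%E]muS -EFinM.
    exact: ltry.
  rewrite -integralD//; [|exact: cS].
  apply: le_integral => //; [exact: cS|by apply: integrableD => //; exact: cS|].
  move=> x; rewrite inE/= /S/window/= in_itv/= => /andP[x1 x2]; rewrite -EFinD lee_fin.
  have xK : c - 3 <= x <= c + 3 by apply/andP; split; lra.
  have /Ld : K (q', x) by split; rewrite /= in_itv.
  move=> /(_ (q, x)); rewrite /K/= !in_itv/= => /(_ (conj qK xK)).
  have nd : n.+1%:R^-1 < d by apply: N1d; exact: leq_maxr.
  have bqq : ball (q', x) d (q, x).
    by split => /=; [rewrite /ball/= qq' addrC addKr ger0_norm// ltW|exact: ballxx].
  move=> /(_ bqq); rewrite ltr_norml => /andP[_].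
  by move: (6 * k.+1%:R)^-1 => v /=; lra.
have : (\int[mu]_(x in S) (L q x)%:E)%E \is a fin_num.
  by apply: integrable_fin_num => //; exact: cS.
case: (\int[mu]_(x in S) (L q x)%:E)%E => // v _ h1 h2.
by have := le_trans h2 h1; rewrite -!EFinD lee_fin lerD2l.
Qed.

End occupation_time.

(** * Almost sure small occupation for [B] and for [B - X] *)

Section drift_removal.
Context (R : realType) d (T : measurableType d) (P : probability T R).
Variables (B : R -> {RV P >-> R}) (t0 x0 b1 b2 : R).

(** The exceptional set of the occupation formula depends on the time and the test function; only
    countably many windows and grid times occur, so one null set suffices. *)
Lemma ae_small_occupation (L : R -> R -> {RV P >-> R}) (c : R) p :
  0 <= t0 -> continuous_process B -> jointly_continuous_local_time B L ->
  {ae P, forall w, small_occupation t0 c p (B ^~ w)}.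
Proof.
move=> t00 cB [cL LE].
have H : {ae P, forall w, forall n i m,
    (\int[lebesgue_measure]_x
       (\1_(window c m) x * L (t0 + i%:R / n.+1%:R) x w)%:E =
     occupation_time (B ^~ w) (window c m) (t0 + i%:R / n.+1%:R))%E}.
  apply: ae_foralln => n; apply: ae_foralln => i; apply: ae_foralln => m.
  apply: LE; first by rewrite addr_ge0// divr_ge0.
    by apply: measurable_indic; exact: measurable_itv.
  by exists 1 => x; rewrite indicE; case: (_ \in _); rewrite ?normr1 ?normr0.
by apply: filterS2 cL H => w cLw Hw; exact: (@local_time_small_occupation _ _ (cB w) t0 c (fun t x => L t x w)).
Qed.

Variable Px : R.-pker R ~> path_space R `[t0, +oo[.

(* The shifted drift 2 x0 - X starts at x0, so the absolute continuity
   hypothesis applies to it; it moves level 0 of B - X to level 2 x0. *)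
Lemma ae_small_occupationB (L : R -> R -> {RV P >-> R}) p :
  0 <= t0 -> conditional_path_law B Px -> continuous_process B ->
  jointly_continuous_local_time B L -> lipschitz_shift_equivalence x0 Px ->
  {ae P, forall w, small_occupation t0 0 p.+1
    (fun t => B t w - euler_limit b1 b2 x0 t0 (B ^~ w) t)}.
Proof.
move=> t00 PxB cB BL equiv.
pose X := euler_limit b1 b2 x0 t0.
pose A t w := x0 + x0 - X w t.
pose N := ~` small_occupation t0 (x0 + x0) p.+1 :
  set (path_space R `[t0, t0 + p.+1%:R]).
have mN : measurable N.
  by apply: measurableC; exact: measurable_small_occupation.
have mB (J : set R) : measurable_fun setT
    ((fun w t => B t w) : T -> path_space R J).
  by apply: measurable_fun_path => t _; exact: measurable_funPT.
have adA : adapted t0 A by exact: euler_limit_adapted.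
have lipA w : (Num.max `|b1| `|b2|).-lipschitz_(`[t0, +oo[) (A ^~ w).
  apply/lipschitz_onP => s t Is It; rewrite /A opprB addrC subrKA distrC.
  by have /lipschitz_onP := @euler_limit_lipschitz R b1 b2 x0 t0 w; exact.
have A0 w : A t0 w = x0 by rewrite /A /X euler_limit0 addrK.
(* By translation this concerns [B] at level [x0], where the local time of [B] gives the answer. *)
have P0 : P [set w | N (fun t => B t w + x0)] = 0%E.
  have -> : [set w | N (fun t => B t w + x0)] =
      ~` ((fun w t => B t w) @^-1` (small_occupation t0 x0 p.+1 :
          set (path_space R `[t0, t0 + p.+1%:R]))).
    apply/funext => w.
    by rewrite /N /= (propext (small_occupationD t0 x0 x0 p.+1 (B ^~ w))).
  apply/negligibleP.
    apply: measurableC; rewrite -[X in measurable X]setTI.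
    apply: (mB `[t0, t0 + p.+1%:R]%classic measurableT).
    exact: measurable_small_occupation.
  exact: (ae_small_occupation x0 p.+1 t00 cB BL).
have := shifted_path_null PxB equiv (ltr0Sn _ p) mN adA A0 lipA P0.
have mA : measurable [set w | N (fun t => B t w + A t (B ^~ w))].
  have JI : `[t0, t0 + p.+1%:R] `<=` `[t0, +oo[.
    by move=> t; rewrite /= !in_itv/= => /andP[-> _].
  have := measurable_path_shift JI adA measurableT mN; rewrite setTI => mNA.
  by have := mB `[t0, +oo[%classic measurableT _ mNA; rewrite setTI.
move/(negligibleP _ mA); apply: negligibleS => w /= nH H; apply: nH.
apply/(small_occupationD t0 0 (x0 + x0)); rewrite add0r.
rewrite (_ : (fun t => _) = fun t => B t w + A t (B ^~ w))//.
by apply/funext => t; rewrite /A -addrA (addrC (- _)).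
Qed.

End drift_removal.

(** * Unique solutions along one path, and the conclusion *)

Section pathwise_solution.
Context (R : realType) (b1 b2 x0 t0 : R) (b : R -> R).
Hypothesis cb : {within `[t0, +oo[, continuous b}.
Hypothesis occ : forall p,
  small_occupation t0 0 p.+1 (fun t => b t - euler_limit b1 b2 x0 t0 b t).

Lemma unique_solution_segment p :
  unique_lipschitz_solution b1 b2 x0 b t0 `[t0, t0 + p.+1%:R].
Proof.
have JI : `[t0, t0 + p.+1%:R] `<=` `[t0, +oo[.
  by move=> t; rewrite /= !in_itv/= => /andP[-> _].
have solX := lipschitz_solutionW JI (euler_limit_solution b1 b2 x0 cb).
exists (euler_limit b1 b2 x0 t0 b) => // Y solY.
apply: small_occupation_unique solX solY (occ p).
exact: continuous_subspaceW cb.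
Qed.

Lemma unique_solution_halfline :
  unique_lipschitz_solution b1 b2 x0 b t0 `[t0, +oo[.
Proof.
have solX := euler_limit_solution b1 b2 x0 cb.
exists (euler_limit b1 b2 x0 t0 b) => // Y solY t.
move=> /set_mem; rewrite /= in_itv/= andbT => tt0.
(* Since [t - t0 < p + 1], uniqueness on a segment of integer length reaches [t]. *)
pose p := Num.truncn (t - t0).
have JI : `[t0, t0 + p.+1%:R] `<=` `[t0, +oo[.
  by move=> s; rewrite /= !in_itv/= => /andP[-> _].
apply: (small_occupation_unique _ (lipschitz_solutionW JI solX)
  (lipschitz_solutionW JI solY) (occ p)).
  exact: continuous_subspaceW cb.
by apply/mem_set; rewrite /= in_itv/= tt0 -lerBlDl ltW// truncnS_gt.
Qed.

End pathwise_solution.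

Theorem theorem2p3 (R : realType) (d : measure_display) (T : measurableType d)
    (P : probability T R) (B : R -> {RV P >-> R}) (t0 x0 beta1 beta2 : R)
    (Px : R.-pker R ~> path_space R `[t0, +oo[) :
  0 < t0 ->
  conditional_path_law B Px ->
  continuous_process B ->
  (exists L : R -> R -> {RV P >-> R}, jointly_continuous_local_time B L) ->
  lipschitz_shift_equivalence x0 Px ->
  (exists s0 : {RV P >-> R},
     (forall w, 0 < s0 w) /\
     {ae P, forall w, unique_lipschitz_solution beta1 beta2 x0 (B ^~ w) t0
                        `[t0, t0 + s0 w]}) /\
  (strong_markov B t0 ->
     {ae P, forall w, unique_lipschitz_solution beta1 beta2 x0 (B ^~ w) t0
                        `[t0, +oo[}).

Proof.
move=> t00 PxB cB [L BL] equiv.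
have occ : {ae P, forall w, forall p, small_occupation t0 0 p.+1
    (fun t => B t w - euler_limit beta1 beta2 x0 t0 (B ^~ w) t)}.
  apply: ae_foralln => p.
  exact: ae_small_occupationB (ltW t00) PxB cB BL equiv.
have cBt w : {within `[t0, +oo[, continuous (B ^~ w)}.
  apply: continuous_subspaceW (cB w) => t; rewrite /= !in_itv/= !andbT.
  by apply: le_trans; exact: ltW.
split; last first.
  by move=> _; apply: filterS occ => w; exact: unique_solution_halfline.
(* A deterministic time is a valid choice of [s0], because the Euler limit is a solution on the
   whole half-line; length 1 is the segment with [p = 0]. *)
exists (cst 1); split => [w|]; first exact: ltr01.
by apply: filterS occ => w Hw; exact: (unique_solution_segment (cBt w) Hw 0).
Qed.
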